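(* Let $(G,b)$, $G=(V,\vec E)$, be a connected, locally finite directed weighted graph with measure $m:V\to(0,\infty)$ such that every vertex $x$ has some $y$ with $(x,y)\in\vec E$, satisfying Assumptions $(\beta)$ and $(\gamma)$. If $H=\frac12(\Delta+\Delta')$ with domain $\mathcal{C}_c(V)$ is essentially self-adjoint in $\ell^2(V,m)$, then $S=\frac12(\overline{\Delta}+\Delta^* )$ with domain $D(\overline{\Delta})$ is a self-adjoint operator.
   Context: A directed weighted graph $(G,b)$, $G=(V,\vec E)$, consists of a countable vertex set $V$, a set $\vec E\subset V\times V$ of directed edges and a weight $b:V\times V\to[0,\infty)$ with $b(x,x)=0$ for all $x$ and $b(x,y)>0$ iff $(x,y)\in\vec E$ (no symmetry of $b$ is assumed). $m:V\to(0,\infty)$ is a measure on $V$. Locally finite: for each $x$ only finitely many $y$ satisfy $(x,y)\in\vec E$ or $(y,x)\in\vec E$. Connected: any two vertices are related by a path, i.e. by a finite sequence of directed edges $(x_1,y_1),\dots,(x_n,y_n)$ with $x_i=y_{i-1}$ going from one of the two vertices to the other. $\mathcal{C}_c(V)$ is the space of finitely supported functions $V\to\mathbb{C}$; $\ell^2(V,m)$ is the Hilbert space with scalar product $(f,g)_m=\sum_{x\in V}m(x)f(x)\overline{g(x)}$. On $\mathcal{C}_c(V)$: $\Delta f(x)=\frac1{m(x)}\sum_{y\in V}b(x,y)(f(x)-f(y))$ and $\Delta' f(x)=\frac1{m(x)}\sum_{y\in V}b(y,x)(f(x)-f(y))$. $\overline{\Delta}$ is the closure of $(\Delta,\mathcal{C}_c(V))$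 in $\ell^2(V,m)$ and $\Delta^*$ is its Hilbert space adjoint. Under $(\beta)$ and $(\gamma)$ one has $D(\overline{\Delta})\subset D(\Delta^* )$, so $S$ is defined on $D(\overline{\Delta})=D(\overline{\Delta})\cap D(\Delta^* )$. Assumption $(\beta)$: for all $x\in V$, $\sum_{y\in V}b(x,y)=\sum_{y\in V}b(y,x)$. Assumption $(\gamma)$: there is a constant $M>0$ such that for all $x\in V$, $\sum_{y\in V}|b(x,y)-b(y,x)|\le M\,m(x)$. *)

(* Defs.v *)
From mathcomp Require Export all_boot all_order all_algebra.
From mathcomp Require Export complex.
From mathcomp Require Export all_classical all_reals all_analysis.

Set Implicit Arguments.
Unset Strict Implicit.
Unset Printing Implicit Defensive.

Export Order.TTheory GRing.Theory Num.Theory.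
Export numFieldNormedType.Exports.

Global Open Scope classical_set_scope.
Global Open Scope ring_scope.
Global Open Scope complex_scope.

Section Digraph.
Variables (R : realType) (V : countType).
Implicit Types (E : rel V) (b : V -> V -> R) (m : V -> R).

Definition weighted_digraph E b :=
  [/\ forall x y, 0 <= b x y,
      forall x, b x x = 0 &
      forall x y, E x y = (0 < b x y)].

Definition locally_finite E :=
  forall x, finite_set [set y | E x y || E y x].

(* [path E x p] with [last x p = y]: the consecutive pairs of [x :: p] are
   directed edges leading from [x] to [y]. *)
Definition dipath E x y := exists2 p : seq V, path E x p & last x p = y.

(* Only one of the two directions is required. The empty path is used only
   for [x = y]. *)
Definition connected_digraph E := forall x y, dipath E x y \/ dipath E y x.

(* On a locally finite graph the sums over [y] below have finite support. *)
Definition assumption_beta b :=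
  forall x, \sum_(y \in [set: V]) b x y = \sum_(y \in [set: V]) b y x.

Definition assumption_gamma b m :=
  exists2 M : R, 0 < M &
    forall x, \sum_(y \in [set: V]) `|b x y - b y x| <= M * m x.

Definition Cc : set (V -> R[i]) := [set f | finite_set [set x | f x != 0]].

Definition laplacian m b (f : V -> R[i]) : V -> R[i] :=
  fun x => ((m x)^-1)%:C * \sum_(y \in [set: V]) (b x y)%:C * (f x - f y).

Definition laplacian' m b (f : V -> R[i]) : V -> R[i] :=
  fun x => ((m x)^-1)%:C * \sum_(y \in [set: V]) (b y x)%:C * (f x - f y).

End Digraph.

Section L2.
Variables (R : realType) (V : countType) (m : V -> R).
Implicit Types f g u v : V -> R[i].

Definition ell2 : set (V -> R[i]) :=
  [set f | (\esum_(x in [set: V]) (m x * Normc.normc (f x) ^+ 2)%:E < +oo)%E].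

(* Sum of an absolutely summable family, from sums of nonnegative terms. *)
Definition rsum (a : V -> R) : R :=
  fine (\esum_(x in [set: V]) (a^\+ x)%:E) -
  fine (\esum_(x in [set: V]) (a^\- x)%:E).

Definition csum (a : V -> R[i]) : R[i] :=
  rsum (fun x => complex.Re (a x)) +i* rsum (fun x => complex.Im (a x)).

Definition dotm f g : R[i] := csum (fun x => (m x)%:C * f x * conjc (g x)).

Definition normm f : R := Num.sqrt (complex.Re (dotm f f)).

(* An (unbounded) operator is identified with its graph. *)
Definition graph := set ((V -> R[i]) * (V -> R[i])).
Implicit Types S T : graph.

Definition graph_of (D : set (V -> R[i])) (A : (V -> R[i]) -> (V -> R[i])) :
  graph := [set p | D p.1 /\ p.2 = A p.1].

Definition dom T : set (V -> R[i]) := [set f | exists u, T (f, u)].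

Definition is_operator T :=
  [/\ T `<=` ell2 `*` ell2,
      T (0, 0),
      forall (a : R[i]) f u g v,
        T (f, u) -> T (g, v) -> T (a *: f + g, a *: u + v) &
      forall f u v, T (f, u) -> T (f, v) -> u = v].

Definition dense_in_ell2 (D : set (V -> R[i])) :=
  forall f, ell2 f -> forall e : R, 0 < e -> exists2 g, D g & normm (f - g) < e.

(* The closure of the graph in [ell2 * ell2]; for a closable operator it is
   the graph of its closure. *)
Definition op_closure T : graph :=
  [set p | [/\ ell2 p.1, ell2 p.2 &
     forall e : R, 0 < e -> exists q,
       [/\ T q, normm (p.1 - q.1) < e & normm (p.2 - q.2) < e]]].

Definition op_adjoint T : graph :=
  [set p | [/\ ell2 p.1, ell2 p.2 &
     forall f u, T (f, u) -> dotm u p.1 = dotm f p.2]].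

Definition self_adjoint T :=
  [/\ is_operator T, dense_in_ell2 (dom T) & op_adjoint T = T].

Definition essentially_self_adjoint T := self_adjoint (op_closure T).

(* [1/2 (S + T)] on [dom S `&` dom T] *)
Definition op_half_sum S T : graph :=
  [set p | exists u v, [/\ S (p.1, u), T (p.1, v) & p.2 = 2^-1 *: (u + v)]].

End L2.

Section Operators.
Variables (R : realType) (V : countType) (m : V -> R) (b : V -> V -> R).

Definition Delta_c : graph R V := graph_of (@Cc R V) (laplacian m b).

Definition Delta_bar : graph R V := op_closure m Delta_c.

(* The adjoint of the closure; it coincides with that of [Delta_c]. *)
Definition Delta_star : graph R V := op_adjoint m Delta_bar.

Definition H_op : graph R V :=
  graph_of (@Cc R V)
    (fun f => 2^-1 *: (laplacian m b f + laplacian' m b f)).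

Definition S_op : graph R V := op_half_sum Delta_bar Delta_star.

End Operators.

(* Main.v *)
(* Put [K = (Delta - Delta') / 2] and write [cl] for operator closure. By
   (beta) the diagonal terms of [K] cancel, so [K] is given by the skew kernel
   [(b y x - b x y) / 2]; by (gamma) and Schur's test it is bounded on [ell2],
   and by Fubini it is skew-adjoint. Since [Delta = H + K] on [Cc] and [cl H]
   is self-adjoint, [cl Delta = cl H + K] and [Delta^* = cl H - K], both on
   the domain of [cl H], so that half their sum is [cl H]. *)
Require Import Defs.
From mathcomp Require Import ring lra.

Set Implicit Arguments.
Unset Strict Implicit.
Unset Printing Implicit Defensive.

(** * Sums of nonnegative families, with values in the extended reals *)

Section NonnegativeSums.
Variables (R : realType) (T : choiceType).
Implicit Types p q a : T -> R.

Definition psum p : \bar R := \esum_(x in [set: T]) (p x)%:E.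

Lemma psum_ge0 p : (forall x, 0 <= p x) -> (0 <= psum p)%E.
Proof. by move=> p0; apply: esum_ge0 => x _; rewrite lee_fin. Qed.

Lemma psum_fin_num p :
  (forall x, 0 <= p x) -> (psum p < +oo)%E -> psum p \is a fin_num.
Proof. by move=> p0 poo; rewrite ge0_fin_numE // psum_ge0. Qed.

Lemma fine_psum_ge0 p : (forall x, 0 <= p x) -> 0 <= fine (psum p).
Proof. by move=> p0; apply: fine_ge0; apply: psum_ge0. Qed.

Lemma psumD p q : (forall x, 0 <= p x) -> (forall x, 0 <= q x) ->
  psum (fun x => p x + q x) = (psum p + psum q)%E.
Proof. by move=> p0 q0; rewrite /psum -esumD // => x _; rewrite lee_fin. Qed.

Lemma le_psum p q : (forall x, p x <= q x) -> (psum p <= psum q)%E.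
Proof. by move=> pq; apply: le_esum => x _; rewrite lee_fin. Qed.

Lemma psumD_lty p q : (forall x, 0 <= p x) -> (forall x, 0 <= q x) ->
  (psum p < +oo)%E -> (psum q < +oo)%E -> (psum (fun x => p x + q x)%R < +oo)%E.
Proof. by move=> p0 q0 poo qoo; rewrite psumD // lte_add_pinfty. Qed.

Lemma psum_lty_le p q : (forall x, p x <= q x) ->
  (psum q < +oo)%E -> (psum p < +oo)%E.
Proof. by move=> pq; apply: le_lt_trans; apply: le_psum. Qed.

(** Every finite partial sum on the left is [c] times one on the right. This also covers an infinite
    [psum p], so bounds can be derived before summability is known. *)
Lemma psumZ_le (c : R) p : 0 <= c -> (forall x, 0 <= p x) ->
  (psum (fun x => c * p x)%R <= c%:E * psum p)%E.
Proof.
move=> c0 p0; rewrite /psum /esum; apply: ge_ereal_sup => _ [X [finX _] <-].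
have -> : (\sum_(x \in X) (c * p x)%:E = c%:E * \sum_(x \in X) (p x)%:E)%E.
  by rewrite !fsumEFin // -EFinM mulr_fsumr.
rewrite lee_wpmul2l ?lee_fin //.
by apply: ereal_sup_ubound; exists X.
Qed.

Lemma psumZ_lty (c : R) p : 0 <= c -> (forall x, 0 <= p x) ->
  (psum p < +oo)%E -> (psum (fun x => c * p x)%R < +oo)%E.
Proof.
move=> c0 p0 poo; apply: le_lt_trans (psumZ_le c0 p0) _.
by rewrite -(fineK (psum_fin_num p0 poo)) -EFinM ltry.
Qed.

Lemma psum_seq (s : seq T) p : uniq s -> (forall x, 0 <= p x) ->
  (forall x, x \notin s -> p x = 0) -> psum p = (\sum_(x <- s) p x)%:E.
Proof.
move=> us p0 ps; transitivity (\esum_(x in [set` s]) (p x)%:E).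
  rewrite esum_mkcond; apply: eq_esum => x _.
  by rewrite mem_setE; case: ifPn => // /ps ->.
rewrite esum_fset; last 2 first.
  - exact: finite_seq.
  - by move=> x _; rewrite lee_fin.
by rewrite -fsbig_seq // sumEFin.
Qed.

Lemma fine_psum_le p q : (forall x, 0 <= p x) -> (forall x, p x <= q x) ->
  (psum q < +oo)%E -> fine (psum p) <= fine (psum q).
Proof.
move=> p0 pq qoo; apply: fine_le; last exact: le_psum.
- by rewrite psum_fin_num //; apply: psum_lty_le qoo.
- by rewrite psum_fin_num // => x; apply: le_trans (pq x).
Qed.

Lemma fine_psumD p q : (forall x, 0 <= p x) -> (forall x, 0 <= q x) ->
  (psum p < +oo)%E -> (psum q < +oo)%E ->
  fine (psum (fun x => p x + q x)) = fine (psum p) + fine (psum q).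
Proof. by move=> *; rewrite psumD // fineD // psum_fin_num. Qed.

Lemma fine_psumZ_le (c : R) p : 0 <= c -> (forall x, 0 <= p x) ->
  (psum p < +oo)%E -> fine (psum (fun x => c * p x)) <= c * fine (psum p).
Proof.
move=> c0 p0 poo; have pfin := psum_fin_num p0 poo.
rewrite -[c * _]/(fine (c * fine (psum p))%:E) EFinM fineK //.
apply: fine_le; last exact: psumZ_le.
- by apply: psum_fin_num; [move=> x; rewrite mulr_ge0 | apply: psumZ_lty].
- by rewrite fin_numM.
Qed.

End NonnegativeSums.

(** Tonelli: both iterated sums equal the sum over the product, up to the swap of coordinates. *)
Lemma psum_exchange (R : realType) (T U : choiceType) (c : T -> U -> R) :
  (forall x y, 0 <= c x y) ->
  (\esum_(x in [set: T]) psum (c x) = \esum_(y in [set: U]) psum (c^~ y))%E.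
Proof.
move=> c0; rewrite /psum esum_esum; last by move=> *; rewrite lee_fin.
rewrite esum_esum; last by move=> *; rewrite lee_fin.
rewrite [RHS](@reindex_esum _ _ _ ([set: T] `*` [set: U]) _
  (fun k => (k.2, k.1))).
  by congr (esum _ _); apply/seteqP; split=> -[x y].
split => [[x y] //|[x y] [x' y'] _ _ [-> ->] //|[y x] _].
by exists (x, y).
Qed.

(** * Signed sums of absolutely summable real families, and Fubini's theorem *)

Section RealSums.
Variables (R : realType) (T : countType).
Implicit Types p q a b : T -> R.

Definition abs_summable a := (psum (fun x => `|a x|)%R < +oo)%E.

Lemma abs_summable_pos a : abs_summable a -> (psum (a^\+)%R < +oo)%E.
Proof.
by apply: psum_lty_le => x; rewrite /funrpos ge_max normr_ge0 ler_norm.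
Qed.

Lemma abs_summable_neg a : abs_summable a -> (psum (a^\-)%R < +oo)%E.
Proof.
by apply: psum_lty_le => x; rewrite /funrneg ge_max normr_ge0 -normrN ler_norm.
Qed.

Lemma funrposBnegE a x : a x = (a^\+) x - (a^\-) x.
Proof. by rewrite -{1}(funrposBneg a). Qed.

Lemma rsumE a : rsum a = fine (psum (a^\+)%R) - fine (psum (a^\-)%R).
Proof. by []. Qed.

(* [p] and [q] need not be the positive and negative parts of [p - q]; the
   linearity of [rsum] and Fubini's theorem both come from this. *)
Lemma rsumB p q : (forall x, 0 <= p x) -> (forall x, 0 <= q x) ->
  (psum p < +oo)%E -> (psum q < +oo)%E ->
  rsum (fun x => p x - q x) = fine (psum p) - fine (psum q).
Proof.
move=> p0 q0 poo qoo; set a := fun x => p x - q x.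
have a_summable : abs_summable a.
  apply: psum_lty_le (psumD_lty p0 q0 poo qoo) => x.
  by rewrite /a ler_norml; have := p0 x; have := q0 x; lra.
have [apos aneg] := (abs_summable_pos a_summable, abs_summable_neg a_summable).
have pos0 x : 0 <= (a^\+) x by [].
have neg0 x : 0 <= (a^\-) x by [].
(* Since [a^+ - a^- = p - q], the nonnegative families [a^+ + q] and [a^- + p] coincide; their sums
   are compared first, and differences are taken only once all four sums are known to be finite. *)
have := psumD pos0 q0.
have -> : (fun x => (a^\+) x + q x) = fun x => (a^\-) x + p x.
  by apply/funext => x; have := funrposBnegE a x; rewrite {1}/a; lra.
rewrite psumD // => /(congr1 fine).
rewrite !fineD ?psum_fin_num // rsumE; lra.
Qed.

Lemma rsumD a b : abs_summable a -> abs_summable b ->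
  rsum (fun x => a x + b x) = rsum a + rsum b.
Proof.
move=> ha hb; have -> : (fun x => a x + b x) =
    fun x => ((a^\+) x + (b^\+) x) - ((a^\-) x + (b^\-) x).
  apply/funext => x; rewrite {1}(funrposBnegE a x) {1}(funrposBnegE b x).
  by lra.
have [ha' hb'] := (abs_summable_pos ha, abs_summable_pos hb).
have [ha'' hb''] := (abs_summable_neg ha, abs_summable_neg hb).
rewrite rsumB; [|by move=> x; rewrite addr_ge0 | by move=> x; rewrite addr_ge0
  | exact: psumD_lty | exact: psumD_lty].
rewrite !psumD // !fineD ?psum_fin_num // !rsumE; lra.
Qed.

Lemma rsumN a : rsum (fun x => - a x) = - rsum a.
Proof.
rewrite !rsumE -[X in fine (psum X) - _]/((\- a)^\+).
rewrite -[X in _ - fine (psum X)]/((\- a)^\-).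
by rewrite funrposN funrnegN opprB.
Qed.

Lemma rsum_ge0 p : (forall x, 0 <= p x) -> rsum p = fine (psum p).
Proof.
move=> p0; rewrite rsumE (_ : p^\+ = p); last first.
  by apply/funext => x; rewrite /funrpos; apply/max_idPl.
rewrite (_ : p^\- = fun=> 0); last first.
  by apply/funext => x; rewrite /funrneg; apply/max_idPr; rewrite oppr_le0.
by rewrite /psum (esum1 (fun _ _ => erefl)) subr0.
Qed.

Lemma rsum_seq (s : seq T) a : uniq s -> (forall x, x \notin s -> a x = 0) ->
  rsum a = \sum_(x <- s) a x.
Proof.
move=> us as0; rewrite rsumE !(psum_seq us) //=.
- by rewrite -sumrB; apply: eq_bigr => x _; rewrite -funrposBnegE.
- by move=> x /as0; rewrite /funrneg => ->; rewrite oppr0 maxxx.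
- by move=> x /as0; rewrite /funrpos => ->; rewrite maxxx.
Qed.

(** Tonelli is applied to the positive and the negative parts of [c] separately. *)
Lemma rsum_exchange (c : T -> T -> R) :
  (\esum_(x in [set: T]) psum (fun y => `|c x y|)%R < +oo)%E ->
  rsum (fun x => rsum (c x)) = rsum (fun y => rsum (c^~ y)).
Proof.
(* A finite double sum has finite inner sums, so taking [fine] of them loses nothing. *)
have pos_half (d : T -> T -> R) : (forall x y, 0 <= d x y) ->
    (\esum_(x in [set: T]) psum (d x) < +oo)%E ->
    (forall x, psum (d x) < +oo)%E /\
    psum (fun x => fine (psum (d x))) = \esum_(x in [set: T]) psum (d x).
  move=> d0 doo; have fin x : (psum (d x) < +oo)%E.
    have := @summable_pinfty _ _ [set: T] (fun x => psum (d x)).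
    rewrite /summable; under eq_esum do rewrite gee0_abs ?psum_ge0 //.
    by move=> /(_ doo x I); rewrite gee0_abs ?psum_ge0.
  by split=> //; apply: eq_esum => x _; rewrite fineK // psum_fin_num.
(* The inner [rsum] is a difference of two nonnegative summable families in [x]. These need not be
   its positive and negative parts, which is why [rsumB] allows arbitrary [p] and [q]. *)
have one_side (d : T -> T -> R) :
    (\esum_(x in [set: T]) psum (fun y => `|d x y|)%R < +oo)%E ->
    rsum (fun x => rsum (d x)) =
    fine (\esum_(x in [set: T]) psum ((d x)^\+)%R) -
    fine (\esum_(x in [set: T]) psum ((d x)^\-)%R).
  move=> doo.
  have posoo : (\esum_(x in [set: T]) psum ((d x)^\+)%R < +oo)%E.
    apply: le_lt_trans doo; apply: le_esum => x _; apply: le_psum => y.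
    by rewrite /funrpos ge_max normr_ge0 ler_norm.
  have negoo : (\esum_(x in [set: T]) psum ((d x)^\-)%R < +oo)%E.
    apply: le_lt_trans doo; apply: le_esum => x _; apply: le_psum => y.
    by rewrite /funrneg ge_max normr_ge0 -normrN ler_norm.
  have [pfin pE] := pos_half _ (fun x y => funrpos_ge0 (d x) y) posoo.
  have [nfin nE] := pos_half _ (fun x y => funrneg_ge0 (d x) y) negoo.
  rewrite -pE -nE -rsumB // ?pE ?nE // => x; exact: fine_psum_ge0.
(* The second use is for the transposed family, whose absolute summability is again Tonelli. *)
move=> coo; rewrite one_side // one_side; last first.
  by rewrite -psum_exchange.
have pos0 x y : 0 <= ((c x)^\+) y by [].
have neg0 x y : 0 <= ((c x)^\-) y by [].
by rewrite (psum_exchange pos0) (psum_exchange neg0).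
Qed.

End RealSums.

(** * The real-valued modulus on [R[i]] *)

Section ComplexModulus.
Variable R : realType.
Implicit Types z w : R[i].
Local Notation normc := (@Normc.normc R).

Lemma normc_ge0 z : 0 <= normc z.
Proof. by case: z => a b; apply: sqrtr_ge0. Qed.

Lemma sqr_normcE z : normc z ^+ 2 = complex.Re z ^+ 2 + complex.Im z ^+ 2.
Proof. by case: z => a b /=; rewrite sqr_sqrtr // addr_ge0 ?sqr_ge0. Qed.

Lemma normc_real (a : R) : normc a%:C = `|a|.
Proof. by rewrite /= expr0n addr0 sqrtr_sqr. Qed.

Lemma normc_conj z : normc (conjc z) = normc z.
Proof. by case: z => a b /=; rewrite sqrrN. Qed.

Lemma normc_sum (I : Type) (s : seq I) (F : I -> R[i]) :
  normc (\sum_(i <- s) F i) <= \sum_(i <- s) normc (F i).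
Proof.
elim: s => [|i s IHs]; first by rewrite !big_nil Normc.normc0.
by rewrite !big_cons (le_trans (le_normcD _ _)) // lerD2l.
Qed.

Lemma abs_Re_le z : `|complex.Re z| <= normc z.
Proof.
rewrite -(@ler_pXn2r _ 2) ?nnegrE ?normc_ge0 // sqr_normcE -normrX.
by rewrite ger0_norm ?sqr_ge0 // lerDl sqr_ge0.
Qed.

Lemma abs_Im_le z : `|complex.Im z| <= normc z.
Proof.
rewrite -(@ler_pXn2r _ 2) ?nnegrE ?normc_ge0 // sqr_normcE -normrX.
by rewrite ger0_norm ?sqr_ge0 // lerDr sqr_ge0.
Qed.

(** The parallelogram identity with the term in [z - w] dropped. It replaces the triangle inequality
    in all [ell2] estimates below. *)
Lemma sqr_normcD_le z w :
  normc (z + w) ^+ 2 <= 2 * normc z ^+ 2 + 2 * normc w ^+ 2.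
Proof.
rewrite !sqr_normcE; case: z w => a b [c d] /=.
by have := sqr_ge0 (a - c); have := sqr_ge0 (b - d); nra.
Qed.

Lemma ReD z w : complex.Re (z + w) = complex.Re z + complex.Re w.
Proof. by case: z w => ? ? [? ?]. Qed.

Lemma ImD z w : complex.Im (z + w) = complex.Im z + complex.Im w.
Proof. by case: z w => ? ? [? ?]. Qed.

Lemma ReN z : complex.Re (- z) = - complex.Re z.
Proof. by case: z. Qed.

Lemma ImN z : complex.Im (- z) = - complex.Im z.
Proof. by case: z. Qed.

Lemma Re_sum (I : Type) (s : seq I) (F : I -> R[i]) :
  complex.Re (\sum_(i <- s) F i) = \sum_(i <- s) complex.Re (F i).
Proof. exact: (big_morph _ ReD). Qed.

Lemma Im_sum (I : Type) (s : seq I) (F : I -> R[i]) :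
  complex.Im (\sum_(i <- s) F i) = \sum_(i <- s) complex.Im (F i).
Proof. exact: (big_morph _ ImD). Qed.

Lemma conjcM z w : conjc (z * w) = conjc z * conjc w.
Proof. exact: rmorphM. Qed.

Lemma conjc_sum (I : Type) (s : seq I) (F : I -> R[i]) :
  conjc (\sum_(i <- s) F i) = \sum_(i <- s) conjc (F i).
Proof. exact: rmorph_sum. Qed.

End ComplexModulus.

(** * Absolutely summable complex families, by real and imaginary parts *)

Section ComplexSums.
Variables (R : realType) (T : countType).
Implicit Types a b : T -> R[i].
Local Notation normc := (@Normc.normc R).

Definition cabs_summable a := (psum (fun x => normc (a x)) < +oo)%E.

Lemma abs_summable_Re a :
  cabs_summable a -> abs_summable (fun x => complex.Re (a x)).
Proof. by apply: psum_lty_le => x; apply: abs_Re_le. Qed.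

Lemma abs_summable_Im a :
  cabs_summable a -> abs_summable (fun x => complex.Im (a x)).
Proof. by apply: psum_lty_le => x; apply: abs_Im_le. Qed.

Lemma csumD a b : cabs_summable a -> cabs_summable b ->
  csum (fun x => a x + b x) = csum a + csum b.
Proof.
move=> ha hb; rewrite /csum.
under eq_fun do rewrite ReD; under [X in _ +i* rsum X]eq_fun do rewrite ImD.
by rewrite (rsumD (abs_summable_Re ha) (abs_summable_Re hb))
  (rsumD (abs_summable_Im ha) (abs_summable_Im hb)).
Qed.

Lemma csumN a : csum (fun x => - a x) = - csum a.
Proof.
rewrite /csum; under eq_fun do rewrite ReN.
by under [X in _ +i* rsum X]eq_fun do rewrite ImN; rewrite !rsumN.
Qed.

Lemma csum_seq (s : seq T) a : uniq s -> (forall x, x \notin s -> a x = 0) ->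
  csum a = \sum_(x <- s) a x.
Proof.
move=> us as0; rewrite /csum !(rsum_seq us); try by move=> x /as0 ->.
by rewrite -Re_sum -Im_sum; case: (\sum_(_ <- _) _).
Qed.

Lemma csum_exchange (c : T -> T -> R[i]) :
  (\esum_(x in [set: T]) psum (fun y => normc (c x y)) < +oo)%E ->
  csum (fun x => csum (c x)) = csum (fun y => csum (c^~ y)).
Proof.
move=> coo; rewrite /csum; congr (_ +i* _).
  apply: (@rsum_exchange _ _ (fun x y => complex.Re (c x y))).
  apply: le_lt_trans coo; apply: le_esum => x _.
  by apply: le_psum => y; apply: abs_Re_le.
apply: (@rsum_exchange _ _ (fun x y => complex.Im (c x y))).
apply: le_lt_trans coo; apply: le_esum => x _.
by apply: le_psum => y; apply: abs_Im_le.
Qed.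

End ComplexSums.

(** * The space [ell2], its norm and its scalar product *)

Section Ell2.
Variables (R : realType) (V : countType) (m : V -> R).
Hypothesis m_gt0 : forall x, 0 < m x.
Implicit Types f g h u v : V -> R[i].
Local Notation normc := (@Normc.normc R).

Let m_ge0 x : 0 <= m x. Proof. exact: ltW. Qed.

Definition sqmass f x : R := m x * normc (f x) ^+ 2.

(** The square of [normm], so that estimates avoid square roots. As [fine] sends [+oo] to 0, it is
    meaningful only on [ell2]. *)
Definition sqnorm f : R := fine (psum (sqmass f)).

Lemma sqmass_ge0 f x : 0 <= sqmass f x.
Proof. by rewrite mulr_ge0 ?sqr_ge0. Qed.

Lemma sqmassD_le f g x : sqmass (f + g) x <= 2 * sqmass f x + 2 * sqmass g x.
Proof.
apply: le_trans (ler_wpM2l (m_ge0 x) (sqr_normcD_le (f x) (g x))) _.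
by rewrite /sqmass mulrDr ![m x * (2 * _)]mulrCA.
Qed.

Lemma ell2D f g : ell2 m f -> ell2 m g -> ell2 m (f + g).
Proof.
move=> hf hg; apply: psum_lty_le (sqmassD_le f g) _.
apply: psumD_lty; try by move=> x; rewrite mulr_ge0 // sqmass_ge0.
all: by apply: psumZ_lty => //; apply: sqmass_ge0.
Qed.

Lemma ell2N f : ell2 m f -> ell2 m (- f).
Proof. by apply: psum_lty_le => x; rewrite normcN. Qed.

Lemma ell2B f g : ell2 m f -> ell2 m g -> ell2 m (f - g).
Proof. by move=> hf hg; apply: ell2D => //; apply: ell2N. Qed.

Lemma ell2_Cc f : Cc f -> ell2 m f.
Proof.
move=> hf; change (psum (sqmass f) < +oo)%E.
rewrite (psum_seq (finmap.fset_uniq (fset_set [set x | f x != 0]))) ?ltry //.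
  exact: sqmass_ge0.
move=> x; rewrite in_fset_set // => /negP; rewrite inE /= => /negP.
by rewrite negbK /sqmass => /eqP ->; rewrite Normc.normc0 expr0n mulr0.
Qed.

Lemma sqnorm_ge0 f : 0 <= sqnorm f.
Proof. by apply: fine_psum_ge0; apply: sqmass_ge0. Qed.

Lemma sqnormD_le f g : ell2 m f -> ell2 m g ->
  sqnorm (f + g) <= 2 * sqnorm f + 2 * sqnorm g.
Proof.
move=> hf hg.
have f0 x : 0 <= 2 * sqmass f x by rewrite mulr_ge0 // sqmass_ge0.
have g0 x : 0 <= 2 * sqmass g x by rewrite mulr_ge0 // sqmass_ge0.
have foo : (psum (fun x => 2 * sqmass f x)%R < +oo)%E.
  by apply: psumZ_lty => //; apply: sqmass_ge0.
have goo : (psum (fun x => 2 * sqmass g x)%R < +oo)%E.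
  by apply: psumZ_lty => //; apply: sqmass_ge0.
apply: le_trans (fine_psum_le _ (sqmassD_le f g) (psumD_lty f0 g0 foo goo)) _.
  exact: sqmass_ge0.
rewrite fine_psumD // lerD // fine_psumZ_le //; exact: sqmass_ge0.
Qed.

Lemma normmE f : normm m f = Num.sqrt (sqnorm f).
Proof.
rewrite /normm /sqnorm -rsum_ge0; last exact: sqmass_ge0.
congr (Num.sqrt (rsum _)); apply/funext => x.
by rewrite /sqmass sqr_normcE; case: (f x) => a b /=; ring.
Qed.

Lemma normm_lt f (e : R) : 0 < e -> (normm m f < e) = (sqnorm f < e ^+ 2).
Proof.
move=> e0; rewrite normmE -(@ltr_pXn2r _ 2) ?nnegrE ?sqrtr_ge0 ?ltW //.
by rewrite sqr_sqrtr // sqnorm_ge0.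
Qed.

(** The pointwise bound of a product of moduli by the sum of their squares suffices. *)
Lemma dotm_summable f g : ell2 m f -> ell2 m g ->
  cabs_summable (fun x => (m x)%:C * f x * conjc (g x)).
Proof.
move=> hf hg; have := psumD_lty (sqmass_ge0 f) (sqmass_ge0 g) hf hg.
apply: psum_lty_le => x.
rewrite !Normc.normcM normc_real normc_conj ger0_norm // /sqmass -mulrDr.
rewrite -mulrA ler_wpM2l //.
have := normc_ge0 (f x); have := normc_ge0 (g x).
by have := sqr_ge0 (normc (f x) - normc (g x)); nra.
Qed.

Lemma dotmDl f g h : ell2 m f -> ell2 m g -> ell2 m h ->
  dotm m (f + g) h = dotm m f h + dotm m g h.
Proof.
move=> hf hg hh; rewrite -csumD; [|exact: dotm_summable..].
by congr csum; apply/funext => x; rewrite /= mulrDr mulrDl.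
Qed.

Lemma dotmDr f g h : ell2 m f -> ell2 m g -> ell2 m h ->
  dotm m f (g + h) = dotm m f g + dotm m f h.
Proof.
move=> hf hg hh; rewrite -csumD; [|exact: dotm_summable..].
by congr csum; apply/funext => x; rewrite /= rmorphD mulrDr.
Qed.

End Ell2.

(** Induction on [s]: when [i] is added, the only new term to control is the cross term
    [2 * a i * t i * T], to be compared with [a i * (A * t i ^+ 2 + Q)]. *)
Lemma weighted_cauchy_schwarz (R : realType) (I : Type) (s : seq I)
    (a t : I -> R) : (forall i, 0 <= a i) ->
  (\sum_(i <- s) a i * t i) ^+ 2 <=
  (\sum_(i <- s) a i) * \sum_(i <- s) a i * t i ^+ 2.
Proof.
move=> a0; elim: s => [|i s IHs]; first by rewrite !big_nil mul0r expr0n.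
rewrite !big_cons; set T := \sum_(_ <- _) _; rewrite -/T in IHs.
set A := \sum_(_ <- _) _ in IHs *; set Q := \sum_(_ <- _) _ in IHs *.
have A0 : 0 <= A by apply: sumr_ge0.
have Q0 : 0 <= Q by apply: sumr_ge0 => j _; rewrite mulr_ge0 ?sqr_ge0.
(* Arithmetic-geometric mean inequality, proved by comparing squares and using the induction
   hypothesis [T ^+ 2 <= A * Q]. *)
have amgm : 2 * T * t i <= A * t i ^+ 2 + Q.
  apply: le_trans (ler_norm _) _.
  have AQ0 : 0 <= A * t i ^+ 2 + Q by rewrite addr_ge0 // mulr_ge0 // sqr_ge0.
  rewrite -(@ler_pXn2r _ 2) ?nnegrE // -normrX ger0_norm ?sqr_ge0 //.
  have := ler_wpM2r (sqr_ge0 (t i)) IHs.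
  by have := sqr_ge0 (A * t i ^+ 2 - Q); lra.
by have := ler_wpM2l (a0 i) amgm; lra.
Qed.

(** * Schur's test and skew-adjointness for a real skew kernel with finite rows *)

Section SkewKernel.
Variables (R : realType) (V : countType) (m : V -> R).
Variables (s : V -> seq V) (A : V -> V -> R) (C : R).
Hypothesis m_gt0 : forall x, 0 < m x.
Hypothesis s_uniq : forall x, uniq (s x).
Hypothesis A_supp : forall x y, y \notin s x -> A x y = 0.
Hypothesis A_skew : forall x y, A x y = - A y x.
Hypothesis C_ge0 : 0 <= C.
Hypothesis A_le : forall x, \sum_(y <- s x) `|A x y| <= C * m x.
Implicit Types f g : V -> R[i].
Local Notation normc := (@Normc.normc R).

Let m_ge0 x : 0 <= m x. Proof. exact: ltW. Qed.

(** Each row is summed over the finite list [s x], so the operator is defined, and linear, on all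
    functions without any summability condition. *)
Definition kernel_op f x : R[i] :=
  ((m x)^-1)%:C * \sum_(y <- s x) (A x y)%:C * f y.

Lemma kernel_opB f g : kernel_op (f - g) = kernel_op f - kernel_op g.
Proof.
apply/funext => x; rewrite -[RHS]mulrBr -sumrB; congr (_ * _).
by apply: eq_bigr => y _; rewrite -mulrBr.
Qed.

Lemma kernel_col_supp x y : x \notin s y -> A x y = 0.
Proof. by rewrite A_skew => /A_supp ->; rewrite oppr0. Qed.

Lemma kernel_row_sum (p : V -> R) : (forall x, 0 <= p x) ->
  (\esum_(x in [set: V]) psum (fun y => `|A x y| * p x)%R <=
   psum (fun x => C * (m x * p x))%R)%E.
Proof.
move=> p0; apply: le_esum => x _.
rewrite (psum_seq (s_uniq x)).
- by rewrite lee_fin -mulr_suml mulrA ler_wpM2r.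
- by move=> y; rewrite mulr_ge0.
- by move=> y /A_supp ->; rewrite normr0 mul0r.
Qed.

(** Tonelli reduces this to the row version, because [|A x y|] is symmetric. *)
Lemma kernel_col_sum (p : V -> R) : (forall x, 0 <= p x) ->
  (\esum_(x in [set: V]) psum (fun y => `|A x y| * p y)%R <=
   psum (fun x => C * (m x * p x))%R)%E.
Proof.
move=> p0; rewrite psum_exchange; last by move=> x y; rewrite mulr_ge0.
apply: le_trans (kernel_row_sum p0); apply: le_esum => y _.
by apply: le_psum => x; rewrite A_skew normrN.
Qed.

(** Cauchy-Schwarz with weights [|A x y|] produces the row sum, at most [C * m x]; this [m x]
    absorbs the [(m x)^-1] that remains from the measure and the squared prefactor. *)
Lemma sqmass_kernel_op_le f x :
  sqmass m (kernel_op f) x <=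
  C * \sum_(y <- s x) `|A x y| * normc (f y) ^+ 2.
Proof.
set Q := \sum_(_ <- _) _.
have Q0 : 0 <= Q by apply: sumr_ge0 => y _; rewrite mulr_ge0 ?sqr_ge0.
have sum_le : normc (\sum_(y <- s x) (A x y)%:C * f y) ^+ 2 <= C * m x * Q.
  apply: le_trans (ler_wpM2r Q0 (A_le x)).
  apply: le_trans (weighted_cauchy_schwarz _ _ _) => //.
  rewrite ler_pXn2r ?nnegrE ?normc_ge0 //; last first.
    by apply: sumr_ge0 => y _; rewrite mulr_ge0 ?normc_ge0.
  apply: le_trans (normc_sum _ _) _; apply: ler_sum => y _.
  by rewrite Normc.normcM normc_real.
rewrite /sqmass /kernel_op Normc.normcM normc_real exprMn.
rewrite ger0_norm ?invr_ge0 // mulrA.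
have -> : m x * (m x)^-1 ^+ 2 = (m x)^-1 by field; rewrite gt_eqF.
by rewrite mulrC ler_pdivrMr // mulrAC.
Qed.

(** Schur's test: one factor [C] comes from the rows, through the pointwise bound, and the other
    from the columns. Stated in the extended reals, it gives both the stability of [ell2] and the
    norm bound. *)
Lemma psum_kernel_op_le f :
  (psum (sqmass m (kernel_op f)) <= C%:E * (C%:E * psum (sqmass m f)))%E.
Proof.
have sq0 x : 0 <= normc (f x) ^+ 2 by exact: sqr_ge0.
apply: le_trans (le_psum (sqmass_kernel_op_le f)) _.
apply: le_trans (psumZ_le C_ge0 _) _.
  by move=> x; apply: sumr_ge0 => y _; rewrite mulr_ge0.
apply: lee_wpmul2l; first by rewrite lee_fin.
apply: le_trans (psumZ_le C_ge0 (sqmass_ge0 m_gt0 f)).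
apply: le_trans (kernel_col_sum sq0); apply: le_esum => x _.
rewrite (psum_seq (s_uniq x)) //.
- by move=> y; rewrite mulr_ge0.
- by move=> y /A_supp ->; rewrite normr0 mul0r.
Qed.

Lemma ell2_kernel_op f : ell2 m f -> ell2 m (kernel_op f).
Proof.
move=> hf; apply: le_lt_trans (psum_kernel_op_le f) _.
by rewrite -(fineK (psum_fin_num (sqmass_ge0 m_gt0 f) hf)) -!EFinM ltry.
Qed.

Lemma sqnorm_kernel_op_le f : ell2 m f ->
  sqnorm m (kernel_op f) <= C ^+ 2 * sqnorm m f.
Proof.
move=> hf; have := psum_kernel_op_le f.
have ffin := psum_fin_num (sqmass_ge0 m_gt0 f) hf.
have Kfin := psum_fin_num (sqmass_ge0 m_gt0 _) (ell2_kernel_op hf).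
by rewrite -(fineK ffin) -(fineK Kfin) -!EFinM lee_fin mulrA.
Qed.

(** Both sides are iterated sums of the same double family [c], in opposite orders; the sign comes
    from [A_skew], and [A] being real it is unaffected by conjugation. *)
Lemma dotm_kernel_op f g : ell2 m f -> ell2 m g ->
  dotm m (kernel_op f) g = - dotm m f (kernel_op g).
Proof.
move=> hf hg; pose c x y := (A x y)%:C * f y * conjc (g x).
have mK x : (m x)%:C * ((m x)^-1)%:C = 1 :> R[i].
  by rewrite -rmorphM mulfV ?rmorph1 // gt_eqF.
have lhs : dotm m (kernel_op f) g = csum (fun x => csum (c x)).
  congr csum; apply/funext => x.
  rewrite (csum_seq (s_uniq x)); last first.
    by move=> y /A_supp; rewrite /c => ->; rewrite !mul0r.
  by rewrite /kernel_op mulrA mK mul1r mulr_suml.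
have rhs : - dotm m f (kernel_op g) = csum (fun y => csum (c^~ y)).
  rewrite -csumN; congr csum; apply/funext => y.
  rewrite (csum_seq (s_uniq y)); last first.
    by move=> x /kernel_col_supp; rewrite /c => ->; rewrite !mul0r.
  rewrite /kernel_op conjcM conjc_real mulrACA mK mul1r conjc_sum mulr_sumr.
  rewrite -sumrN; apply: eq_bigr => x _.
  by rewrite conjcM conjc_real /c [A x y]A_skew rmorphN; ring.
rewrite lhs rhs; apply: csum_exchange.
have sq0 (h : V -> R[i]) x : 0 <= normc (h x) ^+ 2 by exact: sqr_ge0.
(* Absolute summability for Fubini: the term in [f y] is summed by columns and the term in [g x] by
   rows. *)
have bound x y : normc (c x y) <=
    `|A x y| * normc (f y) ^+ 2 + `|A x y| * normc (g x) ^+ 2.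
  rewrite !Normc.normcM normc_real normc_conj -mulrDr -mulrA ler_wpM2l //.
  have := normc_ge0 (f y); have := normc_ge0 (g x).
  by have := sqr_ge0 (normc (f y) - normc (g x)); nra.
have finite h : ell2 m h -> (psum (fun x => C * sqmass m h x)%R < +oo)%E.
  by move=> hh; apply: psumZ_lty => //; apply: sqmass_ge0.
apply: le_lt_trans (lte_add_pinfty (finite _ hf) (finite _ hg)).
apply: le_trans (leeD (kernel_col_sum (sq0 f)) (kernel_row_sum (sq0 g))).
rewrite -esumD.
- apply: le_esum => x _; rewrite -psumD; first exact: le_psum.
  + by move=> y; rewrite mulr_ge0.
  + by move=> y; rewrite mulr_ge0.
- by move=> x _; apply: psum_ge0 => y; rewrite mulr_ge0.
- by move=> x _; apply: psum_ge0 => y; rewrite mulr_ge0.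
Qed.

End SkewKernel.

(** * Closures under bounded perturbations *)

Section ClosurePerturbation.
Variables (R : realType) (V : countType) (m : V -> R).
Hypothesis m_gt0 : forall x, 0 < m x.

(** If [(g, v)] approximates [(f, u)], then [(g, v + L g)] approximates [(f, u + L f)], with second
    error [(u - v) + L (f - g)]. *)
Lemma op_closure_perturb (T T' : graph R V)
    (L : (V -> R[i]) -> (V -> R[i])) (C : R) :
  0 <= C ->
  (forall f g, L (f - g) = L f - L g) ->
  (forall f, ell2 m f -> ell2 m (L f)) ->
  (forall f, ell2 m f -> sqnorm m (L f) <= C ^+ 2 * sqnorm m f) ->
  T `<=` ell2 m `*` ell2 m ->
  (forall f u, T (f, u) -> T' (f, u + L f)) ->
  forall f u, op_closure m T (f, u) -> op_closure m T' (f, u + L f).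
Proof.
move=> C0 LB L_ell2 L_le T_ell2 TT' f u [/= hf hu approx].
split=> //=; first by apply: ell2D => //; apply: L_ell2.
(* With this [d] one has [d <= e], and the bound [2 * d ^+ 2 + 2 * C ^+ 2 * d ^+ 2] from
   [sqnormD_le] stays below [e ^+ 2 = 4 * (1 + C) ^+ 2 * d ^+ 2]. *)
move=> e e0; pose d := e / (2 * (1 + C)).
have C1 : 0 < 2 * (1 + C) by lra.
have d0 : 0 < d by rewrite divr_gt0.
have ed : e = 2 * (1 + C) * d by rewrite /d; field; lra.
have [[g v] [Tgv /= fg uv]] := approx d d0.
have [/= hg hv] := T_ell2 _ Tgv.
exists (g, v + L g); split => /=; first exact: TT'.
  by apply: lt_le_trans fg _; rewrite ed; nra.
move: fg uv; rewrite !normm_lt // => fg uv.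
have -> : u + L f - (v + L g) = (u - v) + L (f - g).
  by rewrite LB opprD addrACA.
have hfg : ell2 m (f - g) by apply: ell2B.
apply: le_lt_trans (sqnormD_le _ _ _) _ => //; [exact: ell2B | exact: L_ell2 |].
have := L_le _ hfg; have := ler_wpM2l (sqr_ge0 C) (ltW fg).
rewrite ed; have : 0 < d ^+ 2 by rewrite exprn_gt0.
by move: uv; nra.
Qed.

End ClosurePerturbation.

(** * Bounded skew perturbations of an essentially self-adjoint operator *)

Section SkewPerturbation.
Variables (R : realType) (V : countType) (m : V -> R) (T T' : graph R V).
Variables (L : (V -> R[i]) -> (V -> R[i])) (C : R).
Hypothesis m_gt0 : forall x, 0 < m x.
Hypothesis C_ge0 : 0 <= C.
Hypothesis LB : forall f g, L (f - g) = L f - L g.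
Hypothesis L_ell2 : forall f, ell2 m f -> ell2 m (L f).
Hypothesis L_le :
  forall f, ell2 m f -> sqnorm m (L f) <= C ^+ 2 * sqnorm m f.
Hypothesis L_skew : forall f g, ell2 m f -> ell2 m g ->
  dotm m (L f) g = - dotm m f (L g).
Hypothesis T_ell2 : T `<=` ell2 m `*` ell2 m.
Hypothesis T'E : forall f u, T' (f, u) <-> T (f, u - L f).

(** Two uses of [op_closure_perturb]: from [T'] to [T] with [- L], and back with [L]. *)
Lemma op_closure_skew_perturb f u :
  op_closure m T' (f, u) <-> op_closure m T (f, u - L f).
Proof.
split.
  apply: (@op_closure_perturb _ _ _ m_gt0 T' T (fun f => - L f) C) => //.
  - by move=> g h; rewrite LB opprD.
  - by move=> g hg; apply: ell2N; apply: L_ell2.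
  - move=> g hg; apply: le_trans (L_le hg); rewrite le_eqVlt; apply/orP; left.
    apply/eqP; congr (fine (psum _)); apply/funext => x.
    by rewrite /sqmass /= normcN.
  - move=> [g v] /T'E /T_ell2 [/= hg hv]; split=> //=.
    by rewrite -[v](subrK (L g)); apply: ell2D => //; apply: L_ell2.
  - by move=> g v /T'E.
rewrite -{2}[u](subrK (L f)).
apply: (op_closure_perturb m_gt0 C_ge0 LB L_ell2 L_le T_ell2) => g v Tgv.
by apply/T'E; rewrite addrK.
Qed.

Hypothesis T_esa : essentially_self_adjoint m T.

(** For bounded [L] the adjoint of [cl T + L] is the adjoint of [cl T] plus that of [L]; here these
    are [cl T] and [- L]. *)
Lemma op_adjoint_skew_perturb g v :
  op_adjoint m (op_closure m T') (g, v) <-> op_closure m T (g, v + L g).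
Proof.
have [_ _ T_adj] := T_esa.
split=> [[/= hg hv adj]|Tgv].
  (* Membership in [cl T] is tested as membership in its adjoint, where [L] can be moved across the
     scalar product. *)
  rewrite -T_adj; split=> //=; first by apply: ell2D => //; apply: L_ell2.
  move=> f h Tfh; have [/= hf hh _] := Tfh.
  have [Lf Lg] := (L_ell2 hf, L_ell2 hg).
  have /adj : op_closure m T' (f, h + L f).
    by apply/op_closure_skew_perturb; rewrite addrK.
  rewrite (dotmDl m_gt0) // L_skew // (dotmDr m_gt0) // => /eqP.
  by rewrite subr_eq => /eqP.
have [/= hg hvL _] := Tgv; have Lg := L_ell2 hg.
have hv : ell2 m v by rewrite -[v](addrK (L g)); apply: ell2B.
split=> //= f u /op_closure_skew_perturb Tfu; have [/= hf huL _] := Tfu.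
move: Tgv; rewrite -T_adj => -[_ _ /(_ _ _ Tfu)] /= adj.
have Lf := L_ell2 hf.
rewrite -[u](subrK (L f)) (dotmDl m_gt0) // adj L_skew // (dotmDr m_gt0) //.
by rewrite addrK.
Qed.

Lemma half_sum_skew_perturb :
  op_half_sum (op_closure m T') (op_adjoint m (op_closure m T')) =
  op_closure m T.
Proof.
have [[_ _ _ T_fun] _ _] := T_esa.
apply/seteqP; split=> -[f w].
  move=> [u [v [/= + + ->]]].
  move=> /op_closure_skew_perturb Tu /op_adjoint_skew_perturb Tv.
  rewrite (_ : 2^-1 *: (u + v) = u - L f) //; apply/funext => x.
  (* Both [u - L f] and [v + L f] are images of [f] under the single-valued [cl T], hence equal. *)
  have /(congr1 (fun h => h x)) uv := T_fun _ _ _ Tu Tv.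
  change (2^-1 * (u x + v x) = u x - L f x).
  have -> : v x = u x - L f x - L f x.
    by apply/eqP; rewrite eq_sym subr_eq; apply/eqP.
  by field.
move=> Tw; exists (w + L f), (w - L f); split.
- by apply/op_closure_skew_perturb; rewrite addrK.
- by apply/op_adjoint_skew_perturb; rewrite subrK.
- apply/funext => x; change (w x = 2^-1 * ((w x + L f x) + (w x - L f x))).
  by field.
Qed.

Lemma dom_closure_skew_perturb :
  dom (op_closure m T') = dom (op_closure m T).
Proof.
apply/seteqP; split=> f [u].
  by move/op_closure_skew_perturb; exists (u - L f).
by move=> Tu; exists (u + L f); apply/op_closure_skew_perturb; rewrite addrK.
Qed.

End SkewPerturbation.

(** * The graph Laplacians as finite sums over neighbours *)

Section Laplacian.
Variables (R : realType) (V : countType) (E : rel V).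
Variables (b : V -> V -> R) (m : V -> R).
Hypothesis hG : weighted_digraph E b.
Hypothesis hfin : locally_finite E.
Hypothesis hbeta : assumption_beta b.

(** Edges of both directions are collected, so that one list supports the rows and the columns of
    [b], hence both Laplacians. *)
Definition neighbours x : seq V :=
  finmap.enum_fset (fset_set [set y | E x y || E y x]).

Lemma neighbours_uniq x : uniq (neighbours x).
Proof. exact: finmap.fset_uniq. Qed.

Lemma mem_neighbours x y : (y \in neighbours x) = E x y || E y x.
Proof. by rewrite in_fset_set ?mem_setE //; apply: hfin. Qed.

Lemma weight_notin x y : y \notin neighbours x -> b x y = 0 /\ b y x = 0.
Proof.
have [b_ge0 _ Eb] := hG; rewrite mem_neighbours !Eb negb_or -!leNgt.
by move=> /andP[xy yx]; split; apply/eqP; rewrite eq_le b_ge0 ?xy ?yx.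
Qed.

Lemma sum_neighbours (U : zmodType) x (F : V -> U) :
  (forall y, y \notin neighbours x -> F y = 0) ->
  \sum_(y \in [set: V]) F y = \sum_(y <- neighbours x) F y.
Proof. exact: fsbigTE. Qed.

(** The off-diagonal kernel of [(Delta - Delta') / 2]; the order of the two weights reflects the
    minus sign before [f y] in the Laplacians. *)
Definition half_skew x y : R := 2^-1 * (b y x - b x y).

Lemma laplacianE f x : laplacian m b f x =
  ((m x)^-1)%:C * \sum_(y <- neighbours x) (b x y)%:C * (f x - f y).
Proof.
rewrite /laplacian (@sum_neighbours _ x) // => y /weight_notin[-> _].
by rewrite mul0r.
Qed.

Lemma laplacian'E f x : laplacian' m b f x =
  ((m x)^-1)%:C * \sum_(y <- neighbours x) (b y x)%:C * (f x - f y).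
Proof.
rewrite /laplacian' (@sum_neighbours _ x) // => y /weight_notin[_ ->].
by rewrite mul0r.
Qed.

Lemma laplacian_symmetric_skew f : laplacian m b f =
  2^-1 *: (laplacian m b f + laplacian' m b f) +
  kernel_op m neighbours half_skew f.
Proof.
apply/funext => x.
change (laplacian m b f x =
  2^-1 * (laplacian m b f x + laplacian' m b f x) +
  kernel_op m neighbours half_skew f x).
rewrite laplacianE laplacian'E /kernel_op.
(* These are the coefficients of [f x] in the two Laplacians; once they agree, the difference of the
   Laplacians involves only the values [f y]. *)
have beta : \sum_(y <- neighbours x) (b x y)%:C =
            \sum_(y <- neighbours x) (b y x)%:C :> R[i].
  rewrite -!rmorph_sum -!sum_neighbours ?hbeta // => y /weight_notin[].
    by [].
  by [].
have sumB (c : V -> R) : \sum_(y <- neighbours x) (c y)%:C * (f x - f y) =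
    (\sum_(y <- neighbours x) (c y)%:C) * f x -
    \sum_(y <- neighbours x) (c y)%:C * f y.
  by rewrite mulr_suml -sumrB; apply: eq_bigr => y _; rewrite mulrBr.
have -> : \sum_(y <- neighbours x) (half_skew x y)%:C * f y =
    2^-1 * (\sum_(y <- neighbours x) (b y x)%:C * f y -
            \sum_(y <- neighbours x) (b x y)%:C * f y).
  rewrite -sumrB mulr_sumr; apply: eq_bigr => y _.
  by rewrite /half_skew rmorphM rmorphB fmorphV rmorph_nat -mulrA mulrBl.
rewrite !sumB beta; move: ((m x)^-1)%:C => k.
by field.
Qed.

(** The value at [x] depends on [f] only at [x] and its neighbours, so the support grows at most by
    the neighbours of the support of [f]. This places the range of [H_op] in [ell2]. *)
Lemma Cc_half_sum_laplacian f :
  Cc f -> Cc (2^-1 *: (laplacian m b f + laplacian' m b f)).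
Proof.
move=> hf; pose N := \bigcup_(y in [set y | f y != 0]) [set x | E y x || E x y].
apply: (@sub_finite_set _ _ ([set y | f y != 0] `|` N)); last first.
  rewrite finite_setU; split=> //.
  by apply: bigcup_finite => // y _; apply: hfin.
move=> x; apply: contraNP => /not_orP[/negP fx Nx].
change (2^-1 * (laplacian m b f x + laplacian' m b f x) == 0).
rewrite laplacianE laplacian'E.
move: fx; rewrite negbK => /eqP fx.
have fy y : y \in neighbours x -> f y = 0.
  rewrite mem_neighbours => xy; apply/eqP/negPn/negP => fy.
  by apply: Nx; exists y => //=; rewrite orbC.
rewrite !big_seq !big1 ?mulr0 ?addr0 ?mulr0 // => y /fy ->;
  by rewrite fx subr0 mulr0.
Qed.

End Laplacian.

(** * Application to the operators of the graph *)

Theorem proposition3p3 (R : realType) (V : countType) (E : rel V)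
    (b : V -> V -> R) (m : V -> R)
    (hG : weighted_digraph E b) (hm : forall x, 0 < m x)
    (hconn : connected_digraph E) (hfin : locally_finite E)
    (hout : forall x, exists y, E x y)
    (hbeta : assumption_beta b) (hgamma : assumption_gamma b m) :
  essentially_self_adjoint m (H_op m b) ->
  dom (S_op m b) = dom (Delta_bar m b) /\ self_adjoint m (S_op m b).
Proof.
move=> H_esa; have [M M0 gamma] := hgamma.
pose s := neighbours E; pose A := half_skew b; pose K := kernel_op m s A.
have s_uniq x : uniq (s x) by apply: neighbours_uniq.
have A_supp x y : y \notin s x -> A x y = 0.
  move=> /(weight_notin hG hfin)[bxy byx].
  by rewrite /A /half_skew bxy byx subrr mulr0.
have A_skew x y : A x y = - A y x by rewrite /A /half_skew -mulrN opprB.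
(* The Schur constant is half that of (gamma), owing to the factor [2^-1] in [half_skew]. *)
have M0' : 0 <= 2^-1 * M by rewrite mulr_ge0 // ltW.
have A_le x : \sum_(y <- s x) `|A x y| <= 2^-1 * M * m x.
  rewrite -mulrA; apply: le_trans (ler_wpM2l _ (gamma x)) => //.
  rewrite (@sum_neighbours _ E _ x); last first.
    by move=> y /(weight_notin hG hfin)[-> ->]; rewrite subrr normr0.
  rewrite mulr_sumr; apply: ler_sum => y _.
  by rewrite /A /half_skew normrM ger0_norm // distrC.
have K_ell2 f : ell2 m f -> ell2 m (K f).
  exact: (ell2_kernel_op hm s_uniq A_supp A_skew M0' A_le).
have H_ell2 : H_op m b `<=` ell2 m `*` ell2 m.
  move=> [f u] [/= hf ->]; split=> /=.
    exact: (ell2_Cc hm hf).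
  exact: (ell2_Cc hm (Cc_half_sum_laplacian m hG hfin hf)).
have DeltaE f u : Delta_c m b (f, u) <-> H_op m b (f, u - K f).
  have fE := laplacian_symmetric_skew m hG hfin hbeta f.
  split=> -[/= hf uE]; split=> //=; first by rewrite uE {1}fE addrK.
  by rewrite fE -uE subrK.
have K_le f : ell2 m f -> sqnorm m (K f) <= (2^-1 * M) ^+ 2 * sqnorm m f.
  exact: (sqnorm_kernel_op_le hm s_uniq A_supp A_skew M0' A_le).
have K_skew f g : ell2 m f -> ell2 m g -> dotm m (K f) g = - dotm m f (K g).
  exact: (dotm_kernel_op hm s_uniq A_supp A_skew M0' A_le).
have KB f g : K (f - g) = K f - K g by apply: kernel_opB.
have S_opE : S_op m b = op_closure m (H_op m b).
  exact: (half_sum_skew_perturb hm M0' KB K_ell2 K_le K_skew H_ell2 DeltaE).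
(* By definition [S_op] lives on the intersection of the domains of [Delta_bar] and [Delta_star].
   Being [cl H], which has the domain of [Delta_bar], it is defined on all of the latter. *)
split; last by rewrite S_opE.
rewrite S_opE /Delta_bar.
by rewrite (dom_closure_skew_perturb hm M0' KB K_ell2 K_le H_ell2 DeltaE).
Qed.
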